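(* Let $H$ be a regular semitopological group which contains a dense subgroup $G$ such that $G$, with the subspace topology inherited from $H$, is a paratopological group. Then $H$ is a paratopological group.
   Context: A semitopological group is a group endowed with a topology such that the group operation is separately continuous. A paratopological group is a semitopological group whose group operation $G\times G\to G$ is (jointly) continuous. All spaces are assumed Hausdorff; in particular ''regular'' includes the Hausdorff separation axiom. *)

(* Defs.v *)
From HB Require Import structures.
From mathcomp Require Import all_boot.
From mathcomp Require Import all_classical topology.

Set Implicit Arguments.
Unset Strict Implicit.
Unset Printing Implicit Defensive.

Local Open Scope classical_set_scope.
Local Open Scope group_scope.

(* No compatibility between the group law and the topology is required. *)
#[short(type="preTopologicalGroupType")]
HB.structure Definition PreTopologicalGroup :=
  {G of Topological G & Group G}.

Definition semitopological_group (G : preTopologicalGroupType) : Prop :=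
  (forall a : G, continuous (fun x : G => a * x)) /\
  (forall a : G, continuous (fun x : G => x * a)).

Definition paratopological_group (G : preTopologicalGroupType) : Prop :=
  semitopological_group G /\ continuous (fun p : G * G => p.1 * p.2).

(* [regular_space] alone does not include any separation of points. *)
Definition regular_hausdorff_space (T : topologicalType) : Prop :=
  regular_space T /\ hausdorff_space T.

(* The alias records the proof that [G] is a subgroup, so that the group
   structure can be inferred from it. *)
Definition subgroup_type (H : groupType) (G : set H)
  (sG : group_closed [in G]) : Type := set_type G.

Section SubgroupGroup.
Context (H : groupType) (G : set H) (sG : group_closed [in G]).

HB.instance Definition _ := SubChoice.copy (subgroup_type sG) (set_type G).
HB.instance Definition _ :=
  SubChoice_isSubGroup.Build H _ (subgroup_type sG) sG.

End SubgroupGroup.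

(* The subspace topology, i.e. the library topology on [set_type G], which is
   the initial topology of the inclusion into [H]. *)
HB.instance Definition _ (H : preTopologicalGroupType) (G : set H)
  (sG : group_closed [in G]) :=
  Topological.copy (subgroup_type sG) (set_type G).

(* Main.v *)
Require Import Defs.
From mathcomp Require Import all_boot.
From mathcomp Require Import all_classical topology.

(** Left and right translations of a semitopological group are continuous, so
    joint continuity of the product need only be checked at the identity
    ([continuous_mul_at1]).  There, regularity turns the problem into a closed
    one: it is enough to find a neighbourhood [V] of [1] with [V * V] inside
    [closure U], for [U] a given neighbourhood of [1].  Joint continuity in the
    dense subgroup [G] provides an open [V] such that products of two points of
    [V `&` G] lie in [U] ([paratopological_subgroup_nbhs1]).  Since [V `&` G] is
    dense in [V] ([open_sub_closure_dense]), and since each translation carries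
    limit points to limit points ([continuous_closure_sub]), the two factors
    can be moved one at a time from [V `&` G] to [V] without leaving
    [closure U]. *)

Set Implicit Arguments.
Unset Strict Implicit.
Unset Printing Implicit Defensive.

Local Open Scope classical_set_scope.
Local Open Scope group_scope.

Lemma continuous_closure_sub (X Y : topologicalType) (f : X -> Y)
    (A : set X) (B : set Y) :
  continuous f -> (forall a, A a -> closure B (f a)) ->
  forall x, closure A x -> closure B (f x).
Proof.
move=> cf fAB x clAx; apply: closed_closure => C /cf fC.
by have [a [Aa Ca]] := clAx _ fC; exists (f a); split=> //; apply: fAB.
Qed.

Lemma open_sub_closure_dense (X : topologicalType) (D V : set X) :
  dense D -> open V -> V `<=` closure (V `&` D).
Proof.
move=> dD oV x Vx B; rewrite nbhsE => -[C [oC Cx] CB].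
have [|y [[Vy Cy] Dy]] := dD (V `&` C) _ (openI oV oC); first by exists x.
by exists y; split=> //; apply: CB.
Qed.

(** Near [(a, b)] the product is [x * y = a * ((a^-1 * x) * (y * b^-1)) * b]:
    translations on the outside, and the product near [(1, 1)] inside. *)
Lemma continuous_mul_at1 (H : preTopologicalGroupType) :
  semitopological_group H ->
  (forall W : set H, nbhs (1 : H) W -> exists2 V : set H, nbhs (1 : H) V &
     forall x y, V x -> V y -> W (x * y)) ->
  paratopological_group H.
Proof.
move=> Hsemi mul1; have [cl cr] := Hsemi; split=> // -[a b] W /= Wab.
have /mul1[V V1 VW] : nbhs (1 : H) [set z | W (a * z * b)].
  have cab : continuous (fun z : H => a * z * b).
    move=> z; apply: (@continuous_comp _ _ _ (fun t => a * t) (fun t => t * b)).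
      exact: cl.
    exact: cr.
  by apply: cab; rewrite mulg1.
exists ([set x | V (a^-1 * x)], [set y | V (y * b^-1)]).
  by split=> /=; [apply: cl; rewrite mulVg | apply: cr; rewrite mulgV].
move=> [x y] [/= Vx Vy]; have := VW _ _ Vx Vy.
by rewrite /= !mulgA mulgV mul1g mulgVK.
Qed.

Lemma paratopological_subgroup_nbhs1 (H : preTopologicalGroupType) (G : set H)
    (sG : group_closed [in G]) (U : set H) :
  paratopological_group (subgroup_type sG) -> nbhs (1 : H) U ->
  exists2 V : set H, open_nbhs (1 : H) V &
    forall x y, (V `&` G) x -> (V `&` G) y -> U (x * y).
Proof.
move=> [_ cmul] U1; pose K := subgroup_type sG.
have val_open_nbhs (A : set K) : nbhs (1 : K) A ->
    exists2 V : set H, open_nbhs (1 : H) V & forall x : K, V (val x) -> A x.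
  move=> [_ [[V oV <-] V1] VA]; exists V; last by move=> x; apply: VA.
  by split=> //; move: V1; rewrite /= gmulf1.
have valU : nbhs ((1 : K) * (1 : K)) (val @^-1` U : set K).
  apply: (@initial_continuous K H val).
  by rewrite mulg1 gmulf1.
have [[A B] /= [A1 B1] AB] := cmul (1, 1) _ valU.
have [V [oV V1] VA] := val_open_nbhs _ A1.
have [V' [oV' V'1] VB] := val_open_nbhs _ B1.
exists (V `&` V'); first by split=> //; apply: openI.
move=> x y [[Vx _] /mem_set Gx] [[_ Vy] /mem_set Gy].
have /= := AB (Sub x Gx : K, Sub y Gy : K).
by apply; split; [apply: VA | apply: VB].
Qed.

Theorem proposition5 (H : preTopologicalGroupType)
    (H_regular : regular_hausdorff_space H)
    (H_semitop : semitopological_group H)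
    (G : set H) (G_subgroup : group_closed [in G])
    (G_dense : dense G)
    (G_paratop : paratopological_group (subgroup_type G_subgroup)) :
  paratopological_group H.
Proof.
apply: continuous_mul_at1 => // W W1; have [cl cr] := H_semitop.
have [U U1 UW] := H_regular.1 _ _ W1.
have [V oV1 VU] := paratopological_subgroup_nbhs1 G_paratop U1.
have VG : V `<=` closure (V `&` G) by apply: open_sub_closure_dense oV1.1.
exists V; first exact: open_nbhs_nbhs.
move=> x y Vx Vy; apply: UW.
(* The left factor moves last, so that the right one ranges over all of [V]
   while the left one is still in [G]. *)
apply: (continuous_closure_sub (f := fun z => z * y) _ _ (VG _ Vx)) => // g VGg.
apply: (continuous_closure_sub (f := fun z => g * z) _ _ (VG _ Vy)) => // h VGh.
by apply: subset_closure; apply: VU.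
Qed.
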